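(* Assume that $f\in C^2([0,1])$, and let $u_h^{FE}\in V_h$ and $u_h^{FD}\in V_h$ be the functions corresponding to the finite element and the finite difference solutions, respectively, of the boundary value problem $-u''=f$ on $(0,1)$, $u(0)=u(1)=0$, on the nodes $0=x_0<x_1<\cdots<x_n=1$. Let $h=\max_{1\le i\le n}(x_i-x_{i-1})$. Then $$|u_h^{FE}-u_h^{FD}|\le h^2\left(\frac{\|f''\|_\infty}{12}+\frac{\|f'\|_\infty}{6}\right),$$ where $|v|=\left(\int_0^1(v'(x))^2\,dx\right)^{1/2}$ is the energy norm.
   Context: Let $n\ge 2$; the nodes may be non-uniformly spaced, and $h_j=x_j-x_{j-1}$ for $j=1,\dots,n$. $V_h$ is the space of continuous functions on $[0,1]$ that are linear on each $[x_j,x_{j+1}]$ and vanish at $0$ and $1$, with nodal basis $\{\varphi_j\}_{j=1}^{n-1}$, $\varphi_i(x_j)=\delta_{ij}$. The finite element solution $u_h^{FE}\in V_h$ is the unique function satisfying $\int_0^1 (u_h^{FE})'v_h'\,dx=\int_0^1 f v_h\,dx$ for all $v_h\in V_h$. The finite difference solution is the vector $u^{FD}=[u_1,\dots,u_{n-1}]^T$ solving $S\,u^{FD}=W\tilde f$, and the corresponding function is $u_h^{FD}=\sum_{i=1}^{n-1}u_i\varphi_i$. Here $S$ is the (invertible) symmetric tridiagonal $(n-1)\times(n-1)$ matrix with $S_{jj}=\frac1{h_j}+\frac1{h_{j+1}}$ for $1\le j\le n-1$, $S_{j,j+1}=S_{j+1,j}=-\frac1{h_{j+1}}$ for $1\le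 j\le n-2$, and all other entries zero; $W$ is the diagonal matrix with $W_{jj}=\frac{h_j+h_{j+1}}2$; and $\tilde f=[f(x_1),\dots,f(x_{n-1})]^T$. For continuous $\theta$ on $[0,1]$, $\|\theta\|_\infty=\max_{x\in[0,1]}|\theta(x)|$. *)

(* Defs.v *)
From Stdlib Require Import Reals RList List.
From Coquelicot Require Import Coquelicot.
Open Scope R_scope.

(* Functions on [0,1] are represented by total functions on R whose values
   outside [0,1] are irrelevant: differentiability and continuity at the
   endpoints are one-sided, via the Stdlib relative notions [D_in] and
   [continue_in]. *)
Definition I01 (t : R) : Prop := 0 <= t <= 1.

Definition cont01 (g : R -> R) : Prop :=
  forall t, I01 t -> continue_in g I01 t.

(* f belongs to C^2([0,1]) with f' = f1 and f'' = f2 on [0,1]. *)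
Definition C2_01 (f f1 f2 : R -> R) : Prop :=
  (forall t, I01 t -> D_in f f1 I01 t) /\
  (forall t, I01 t -> D_in f1 f2 I01 t) /\
  cont01 f /\ cont01 f1 /\ cont01 f2.

(* A supremum, attained (hence a maximum) when g is continuous on [0,1]. *)
Definition norm_inf (g : R -> R) : R :=
  real (Lub_Rbar (fun y => exists t, I01 t /\ y = Rabs (g t))).

Definition mesh (n : nat) (x : nat -> R) : Prop :=
  x 0%nat = 0 /\ x n = 1 /\ forall j, (j < n)%nat -> x j < x (S j).

(* Meaningful for j >= 1. *)
Definition hstep (x : nat -> R) (j : nat) : R := x j - x (j - 1)%nat.

Definition mesh_size (n : nat) (x : nat -> R) : R :=
  MaxRlist (map (hstep x) (seq 1 n)).

Definition in_Vh (n : nat) (x : nat -> R) (v : R -> R) : Prop :=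
  cont01 v /\
  (forall j, (j < n)%nat ->
     exists a b, forall t, x j <= t <= x (S j) -> v t = a + b * t) /\
  v 0 = 0 /\ v 1 = 0.

Definition kron (i j : nat) : R := if Nat.eq_dec i j then 1 else 0.

Definition nodal_basis (n : nat) (x : nat -> R) (phi : nat -> R -> R) : Prop :=
  forall i, (1 <= i <= n - 1)%nat ->
    in_Vh n x (phi i) /\
    forall j, (j <= n)%nat -> phi i (x j) = kron i j.

(* Elements of V_h are differentiable on (0,1) except possibly at the nodes,
   where [Derive] takes some arbitrary value; this finite set does not affect
   the Riemann integrals below. *)
Definition is_FE_solution (n : nat) (x : nat -> R) (f u : R -> R) : Prop :=
  in_Vh n x u /\
  forall v, in_Vh n x v ->
    RInt (fun t => Derive u t * Derive v t) 0 1 = RInt (fun t => f t * v t) 0 1.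

Definition energy_norm (v : R -> R) : R :=
  sqrt (RInt (fun t => (Derive v t) ^ 2) 0 1).

(* Matrix entries in terms of node numbers 1 <= i, j <= n - 1; Coquelicot
   matrices are indexed from 0, hence the shifts below. *)
Definition S_entry (x : nat -> R) (i j : nat) : R :=
  if Nat.eq_dec i j then 1 / hstep x j + 1 / hstep x (j + 1)
  else if Nat.eq_dec j (i + 1) then - (1 / hstep x (i + 1))
  else if Nat.eq_dec i (j + 1) then - (1 / hstep x (j + 1))
  else 0.

Definition W_entry (x : nat -> R) (i j : nat) : R :=
  if Nat.eq_dec i j then (hstep x j + hstep x (j + 1)) / 2 else 0.

Definition S_mat (n : nat) (x : nat -> R) : matrix (n - 1) (n - 1) :=
  mk_matrix (n - 1) (n - 1) (fun i j => S_entry x (i + 1) (j + 1)).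

Definition W_mat (n : nat) (x : nat -> R) : matrix (n - 1) (n - 1) :=
  mk_matrix (n - 1) (n - 1) (fun i j => W_entry x (i + 1) (j + 1)).

Definition f_vec (n : nat) (x : nat -> R) (f : R -> R) : matrix (n - 1) 1 :=
  mk_matrix (n - 1) 1 (fun i _ => f (x (i + 1)%nat)).

Definition is_FD_solution (n : nat) (x : nat -> R) (f : R -> R)
    (U : @matrix R (n - 1) 1) : Prop :=
  Mmult (S_mat n x) U = Mmult (W_mat n x) (f_vec n x f).

Definition Vh_fun (n : nat) (phi : nat -> R -> R)
    (U : @matrix R (n - 1) 1) (t : R) : R :=
  sum_n_m (fun i => coeff_mat 0 U (i - 1) 0 * phi i t) 1 (n - 1).

(* Main.v *)
Require Import Defs.
From Stdlib Require Import Reals RList List Arith Lra Lia.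
From Coquelicot Require Import Coquelicot.
Open Scope R_scope.

(* Put [e = uFE - uFD].  Summing the finite difference equations by parts gives
   [int uFD' e' = sum_j h_j/2 (f e (x_{j-1}) + f e (x_j))], so finite differences
   are finite elements with the trapezoidal rule applied to the load [int f e].
   Hence [|e|^2] is the error of the composite trapezoidal rule for [f e].  On an
   element [[a,b]] this error is [1/2 int (t-a)(t-b) (f e)''], with
   [(f e)'' = f'' e + 2 f' e'] as [e] is affine there.  Since [e] vanishes at 0,
   both [max |e|] and [int |e'|] are at most [A = sum_j |e(x_j) - e(x_{j-1})|],
   and [A <= |e|] by Cauchy-Schwarz, whence [|e|^2 <= C A <= C |e|]. *)

(** * Extension from [0,1] to the real line, and the supremum norm *)

Definition clamp (t : R) : R := Rmax 0 (Rmin 1 t).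

Lemma clamp_I01 t : I01 (clamp t).
Proof.
  unfold I01, clamp; split; [apply Rmax_l|].
  apply Rmax_lub; [lra | apply Rmin_l].
Qed.

Lemma clamp_id t : I01 t -> clamp t = t.
Proof. intros [H0 H1]; unfold clamp; rewrite Rmin_right, Rmax_right; lra. Qed.

Lemma clamp_nonexpansive s t : Rabs (clamp s - clamp t) <= Rabs (s - t).
Proof.
  unfold clamp, Rmax, Rmin.
  repeat destruct (Rle_dec _ _); unfold Rabs; repeat destruct (Rcase_abs _); lra.
Qed.

(** Relative continuity only compares points of [0,1]. As [clamp] retracts the line onto [0,1]
    without increasing distances, a relative modulus at [clamp t] serves at [t]. *)
Lemma continuity_clamp g t : cont01 g -> continuity_pt (fun s => g (clamp s)) t.
Proof.
  intros Hg eps Heps.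
  destruct (Hg _ (clamp_I01 t) eps Heps) as [alp [Halp H]].
  exists alp; split; [exact Halp|]; intros s [_ Hs]; simpl in *; unfold Rdist in *.
  (* The relative limit excludes its base point, and [clamp] is not injective, so coinciding images
     are treated apart. *)
  destruct (Req_dec (clamp s) (clamp t)) as [->|Hne].
  - rewrite Rminus_diag, Rabs_R0; exact Heps.
  - apply H; split; [split; [apply clamp_I01 | auto]|].
    eapply Rle_lt_trans; [apply clamp_nonexpansive | exact Hs].
Qed.

Lemma is_derive_clamp g g' t : D_in g g' I01 t -> 0 < t < 1 ->
  is_derive (fun s => g (clamp s)) t (g' t).
Proof.
  intros Hg Ht; apply is_derive_Reals; intros eps Heps.
  destruct (Hg eps Heps) as [alp [Halp H]].
  assert (Hd : 0 < Rmin alp (Rmin t (1 - t))).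
  { repeat apply Rmin_glb_lt; lra. }
  exists (mkposreal _ Hd); intros k Hk0 Hk; simpl in Hk.
  assert (Hk1 := Rlt_le_trans _ _ _ Hk (Rmin_l _ _)).
  assert (Hk2 := Rlt_le_trans _ _ _ Hk (Rmin_r _ _)).
  assert (Hk3 := Rlt_le_trans _ _ _ Hk2 (Rmin_l _ _)).
  assert (Hk4 := Rlt_le_trans _ _ _ Hk2 (Rmin_r _ _)).
  apply Rabs_def2 in Hk3; apply Rabs_def2 in Hk4.
  assert (Htk : I01 (t + k)) by (split; lra).
  rewrite !clamp_id by (exact Htk || (split; lra)).
  specialize (H (t + k)); simpl in H; unfold Rdist in H.
  replace (t + k - t) with k in H by ring.
  apply H; repeat split; try apply Htk; lra.
Qed.

Lemma D_in_cont01 g g' : (forall t, I01 t -> D_in g g' I01 t) -> cont01 g.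
Proof. intros H t Ht; exact (cont_deriv _ _ _ _ (H t Ht)). Qed.

(** The mean value theorem for [G - g o clamp]: the derivative vanishes on the open interval, and
    continuity suffices at the endpoints, where [g o clamp] may have a kink. *)
Lemma eq01_of_derivatives g g' G :
  (forall t, I01 t -> D_in g g' I01 t) ->
  (forall t, is_derive G t (g' (clamp t))) -> G 0 = g 0 ->
  forall t, I01 t -> G t = g t.
Proof.
  intros Hg HG H0 t Ht.
  destruct (MVT_gen (fun s => G s - g (clamp s)) 0 t (fun _ => 0)) as [c [_ Hc]].
  - intros s Hs; rewrite Rmin_left, Rmax_right in Hs by apply Ht.
    assert (0 < s < 1) by (destruct Ht; lra).
    replace 0 with (minus (g' (clamp s)) (g' s)).
    2: { rewrite clamp_id by (split; lra); unfold minus, plus, opp; simpl; ring. }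
    apply (is_derive_minus G (fun s => g (clamp s)));
      [apply HG | apply is_derive_clamp; [apply Hg; split; lra | lra]].
  - intros s _; apply continuity_pt_minus.
    + apply continuity_pt_filterlim, (ex_derive_continuous G); eexists; apply HG.
    + apply continuity_clamp, (D_in_cont01 _ g'), Hg.
  - rewrite (clamp_id t Ht), (clamp_id 0) in Hc by (split; lra); lra.
Qed.

(** Composing [g] with [clamp] may break differentiability at 0 and 1. Integrating the continuous
    function [g' o clamp] instead gives an extension with a two-sided derivative everywhere. *)
Lemma extend_derivative g g' : (forall t, I01 t -> D_in g g' I01 t) -> cont01 g' ->
  exists G, (forall t, I01 t -> G t = g t) /\ forall t, is_derive G t (g' (clamp t)).
Proof.
  intros Hg Hg'.
  assert (Hc : forall t, continuous (fun s => g' (clamp s)) t).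
  { intros t; apply continuity_pt_filterlim, continuity_clamp, Hg'. }
  set (G := fun t => g 0 + RInt (fun s => g' (clamp s)) 0 t).
  assert (HG : forall t, is_derive G t (g' (clamp t))).
  { intros t; unfold G.
    replace (g' (clamp t)) with (plus zero (g' (clamp t))) by apply plus_zero_l.
    apply (is_derive_plus (fun _ => g 0)); [exact (is_derive_const (V := R_NormedModule) (g 0) t)|].
    apply (is_derive_RInt (fun s => g' (clamp s)) _ 0); [|apply Hc].
    apply filter_forall; intros s; apply (RInt_correct (V := R_CompleteNormedModule)).
    apply (ex_RInt_continuous (V := R_CompleteNormedModule)); intros; apply Hc. }
  exists G; split; [|exact HG].
  apply eq01_of_derivatives with g'; try assumption.
  unfold G; rewrite RInt_point; unfold zero; simpl; ring.
Qed.

(** [F] and [F1] are extended independently of each other, so [F1] is asserted to be the derivative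
    of [F] on [0,1] only. *)
Lemma C2_extension f f1 f2 : C2_01 f f1 f2 ->
  exists F F1, (forall t, I01 t -> F t = f t) /\ (forall t, I01 t -> F1 t = f1 t) /\
    (forall t, I01 t -> is_derive F t (F1 t)) /\
    (forall t, is_derive F1 t (f2 (clamp t))).
Proof.
  intros [Hf [Hf1 [_ [Cf1 Cf2]]]].
  destruct (extend_derivative f f1 Hf Cf1) as [F [HF DF]].
  destruct (extend_derivative f1 f2 Hf1 Cf2) as [F1 [HF1 DF1]].
  exists F, F1; split; [exact HF|]; split; [exact HF1|]; split; [|exact DF1].
  intros t Ht; rewrite (HF1 t Ht); rewrite <- (clamp_id t Ht) at 2; apply DF.
Qed.

(** [real] sends an infinite supremum to 0, so finiteness is the point: the maximum of [|g o clamp|]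
    over [0,1] bounds the set from above, and the set is inhabited. *)
Lemma norm_inf_ge g t : cont01 g -> I01 t -> Rabs (g t) <= norm_inf g.
Proof.
  intros Hg Ht; unfold norm_inf.
  set (E := fun y => exists s, I01 s /\ y = Rabs (g s)).
  destruct (Lub_Rbar_correct E) as [Hub Hlub].
  assert (HE : E (Rabs (g t))) by (exists t; auto).
  destruct (continuity_ab_maj (fun s => Rabs (g (clamp s))) 0 1) as [M [HM _]]; [lra| |].
  { intros c _; apply (continuity_pt_comp (fun s => g (clamp s)) Rabs);
      [apply continuity_clamp, Hg | apply Rcontinuity_abs]. }
  assert (HB : is_ub_Rbar E (Rabs (g (clamp M)))).
  { intros y [s [Hs ->]]; simpl.
    rewrite <- (clamp_id s Hs) at 1; apply (HM s Hs). }
  specialize (Hlub _ HB); specialize (Hub _ HE).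
  destruct (Lub_Rbar E); simpl in *; tauto.
Qed.

Lemma norm_inf_pos g : cont01 g -> 0 <= norm_inf g.
Proof.
  intros Hg; eapply Rle_trans; [apply Rabs_pos | apply (norm_inf_ge g 0 Hg); split; lra].
Qed.

(** * Trapezoidal rule on one element, by the Peano kernel *)

Lemma trapezoid_error F F1 F2 a b p s M1 M2 V :
  a <= b ->
  (forall t, a <= t <= b -> is_derive F t (F1 t)) ->
  (forall t, a <= t <= b -> is_derive F1 t (F2 t)) ->
  (forall t, a <= t <= b -> continuous F2 t) ->
  (forall t, a <= t <= b -> Rabs (F1 t) <= M1) ->
  (forall t, a <= t <= b -> Rabs (F2 t) <= M2) ->
  (forall t, a <= t <= b -> Rabs (p + s * t) <= V) ->
  exists T, is_RInt (fun t => F t * (p + s * t)) a b T /\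
    Rabs (T - (b - a) / 2 * (F a * (p + s * a) + F b * (p + s * b)))
      <= (b - a) ^ 3 / 12 * (M2 * V + 2 * M1 * Rabs s).
Proof.
  intros Hab DF DF1 CF2 HM1 HM2 HV.
  assert (CF1 : forall t, a <= t <= b -> continuous F1 t).
  { intros t Ht; apply (ex_derive_continuous F1); eexists; apply DF1, Ht. }
  assert (CF : forall t, a <= t <= b -> continuous F t).
  { intros t Ht; apply (ex_derive_continuous F); eexists; apply DF, Ht. }
  assert (Clin : forall c d t, continuous (fun t => c + d * t) t).
  { intros c d t; apply (ex_derive_continuous (fun t => c + d * t)).
    auto_derive; exact I. }
  set (K := fun t => (t - a) * (t - b) / 2).
  assert (CK : forall t, continuous K t).
  { intros t; apply (ex_derive_continuous K); unfold K; auto_derive; exact I. }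
  set (g := fun t => F t * (p + s * t)).
  set (g2 := fun t => F2 t * (p + s * t) + F1 t * (2 * s)).
  (* [(K' g - K g')' = g - K g''] since [K'' = 1]; [K] vanishes at both ends. *)
  set (P := fun t => (t - (a + b) / 2) * g t - K t * (F1 t * (p + s * t) + F t * s)).
  assert (Cg : forall t, a <= t <= b -> continuous g t).
  { intros t Ht; apply (continuous_mult F (fun t => p + s * t)); auto. }
  assert (Cg2 : forall t, a <= t <= b -> continuous (fun t => K t * g2 t) t).
  { intros t Ht; apply (continuous_mult K g2); [apply CK|].
    apply (continuous_plus (fun t => F2 t * (p + s * t)) (fun t => F1 t * (2 * s))).
    - apply (continuous_mult F2 (fun t => p + s * t)); auto.
    - apply (continuous_mult F1 (fun _ => 2 * s)); [auto | apply continuous_const]. }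
  assert (IP : is_RInt (fun t => g t - K t * g2 t) a b (minus (P b) (P a))).
  { apply (is_RInt_derive P); rewrite Rmin_left, Rmax_right by exact Hab.
    - intros t Ht; assert (D0 := DF t Ht); assert (D1 := DF1 t Ht).
      unfold P, K, g, g2; auto_derive.
      + repeat split; try (eexists; eassumption).
      + replace (Derive (fun x => F x) t) with (F1 t)
          by (symmetry; apply is_derive_unique, D0).
        replace (Derive (fun x => F1 x) t) with (F2 t)
          by (symmetry; apply is_derive_unique, D1).
        field.
    - intros t Ht; apply (continuous_minus g (fun t => K t * g2 t)); auto. }
  assert (XK : exists J : R, is_RInt (fun t => K t * g2 t) a b J).
  { apply (ex_RInt_continuous (V := R_CompleteNormedModule)).
    intros t; rewrite Rmin_left, Rmax_right by exact Hab; apply Cg2. }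
  destruct XK as [J HJ].
  exists ((P b - P a) + J); split.
  - apply (is_RInt_ext (fun t => plus (g t - K t * g2 t) (K t * g2 t))).
    + intros t _; unfold plus, g; simpl; ring.
    + apply (is_RInt_plus (V := R_NormedModule)); assumption.
  (* As [K] vanishes at both ends, [P b - P a] is exactly the trapezoidal value, and the error is
     [J], the integral of [K * g2]. *)
  - replace (P b - P a + J - _) with J by (unfold P, K, g; field).
    set (C := M2 * V + 2 * M1 * Rabs s).
    (* [Q] is a primitive of [- K * C]. Since [K <= 0] on the element, [- K] is [|K|], whose
       integral is [(b - a)^3 / 12]. *)
    set (Q := fun t => - C / 2 * (t ^ 3 / 3 - (a + b) * t ^ 2 / 2 + a * b * t)).
    replace ((b - a) ^ 3 / 12 * C) with (minus (Q b) (Q a))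
      by (change (Q b - Q a = (b - a) ^ 3 / 12 * C); unfold Q; field).
    apply (norm_RInt_le (V := R_NormedModule) (fun t => K t * g2 t) (fun t => - K t * C) a b);
      [exact Hab| |exact HJ|].
    + intros t Ht; unfold norm; simpl; unfold abs; simpl.
      assert (HK : K t <= 0) by (unfold K; nra).
      rewrite Rabs_mult, (Rabs_left1 (K t)) by exact HK.
      apply Rmult_le_compat_l; [lra|].
      unfold g2; eapply Rle_trans; [apply Rabs_triang|].
      rewrite !Rabs_mult, (Rabs_pos_eq 2) by lra.
      assert (Rabs (F2 t) * Rabs (p + s * t) <= M2 * V).
      { apply Rmult_le_compat; auto using Rabs_pos. }
      assert (Rabs (F1 t) * Rabs s <= M1 * Rabs s).
      { apply Rmult_le_compat_r; auto using Rabs_pos. }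
      unfold C; lra.
    + apply (is_RInt_derive Q).
      * intros t _; unfold Q, K; auto_derive; [exact I | field].
      * intros t _; apply (ex_derive_continuous (fun t => - K t * C)).
        unfold K; auto_derive; exact I.
Qed.

(** * Meshes and piecewise linear functions *)

Lemma is_RInt_mesh (x : nat -> R) (g : R -> R) (I : nat -> R) m :
  (forall j, (j <= m)%nat -> is_RInt g (x j) (x (S j)) (I j)) ->
  is_RInt g (x 0%nat) (x (S m)) (sum_f_R0 I m).
Proof.
  induction m as [|m IH]; intros H; simpl; [apply H; lia|].
  apply (is_RInt_Chasles (V := R_NormedModule)) with (x (S m));
    [apply IH; intros; apply H; lia | apply H; lia].
Qed.

Lemma sum_telescope (a : nat -> R) m :
  sum_f_R0 (fun j => a (S j) - a j) m = a (S m) - a 0%nat.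
Proof. induction m as [|m IH]; simpl; [|rewrite IH]; ring. Qed.

Lemma mesh_mono n x i j : mesh n x -> (i <= j <= n)%nat -> x i <= x j.
Proof.
  intros [_ [_ H]] [Hij Hj]; induction Hij as [|j Hij IH]; [lra|].
  specialize (H j Hj); specialize (IH ltac:(lia)); lra.
Qed.

Lemma mesh_I01 n x j : mesh n x -> (j <= n)%nat -> I01 (x j).
Proof.
  intros Hx Hj; assert (H := Hx); destruct H as [H0 [H1 _]].
  split; [rewrite <- H0 | rewrite <- H1]; apply mesh_mono with n; auto; lia.
Qed.

Lemma hstep_S x j : hstep x (S j) = x (S j) - x j.
Proof. unfold hstep; simpl; rewrite Nat.sub_0_r; reflexivity. Qed.

Lemma mesh_size_ge n x j : (j < n)%nat -> x (S j) - x j <= mesh_size n x.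
Proof.
  intros Hj; rewrite <- hstep_S; apply MaxRlist_P1, in_map, in_seq; lia.
Qed.

Definition slope (x : nat -> R) (v : R -> R) (j : nat) : R :=
  (v (x (S j)) - v (x j)) / (x (S j) - x j).

Lemma in_Vh_linear n x v j t : mesh n x -> in_Vh n x v -> (j < n)%nat ->
  x j <= t <= x (S j) ->
  v t = (v (x j) - slope x v j * x j) + slope x v j * t.
Proof.
  intros [_ [_ Hx]] [_ [Hl _]] Hj Ht; specialize (Hx j Hj).
  destruct (Hl j Hj) as [a [b H]].
  unfold slope; rewrite !H by lra; field; lra.
Qed.

Lemma in_Vh_Derive n x v j t : mesh n x -> in_Vh n x v -> (j < n)%nat ->
  x j < t < x (S j) -> Derive v t = slope x v j.
Proof.
  intros Hx Hv Hj Ht.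
  rewrite (Derive_ext_loc v (fun t => (v (x j) - slope x v j * x j) + slope x v j * t)).
  - apply is_derive_unique; auto_derive; [exact I | ring].
  - apply (locally_interval _ t (x j) (x (S j))); simpl; try lra.
    intros s H1 H2; apply in_Vh_linear with n; simpl in *; auto; lra.
Qed.

Lemma in_Vh_bc n x v : mesh n x -> in_Vh n x v -> v (x 0%nat) = 0 /\ v (x n) = 0.
Proof. intros [-> [-> _]] [_ [_ H]]; exact H. Qed.

Lemma in_Vh_lincomb n x u v c d : in_Vh n x u -> in_Vh n x v ->
  in_Vh n x (fun t => c * u t + d * v t).
Proof.
  intros [Cu [Lu [U0 U1]]] [Cv [Lv [V0 V1]]]; repeat split.
  - intros t Ht; apply limit_plus; apply limit_mul.
    + apply (limit_free (fun _ => c) _ t t).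
    + apply Cu, Ht.
    + apply (limit_free (fun _ => d) _ t t).
    + apply Cv, Ht.

  - intros j Hj; destruct (Lu j Hj) as [a [b H]], (Lv j Hj) as [a' [b' H']].
    exists (c * a + d * a'), (c * b + d * b'); intros t Ht.
    rewrite H, H' by exact Ht; ring.
  - rewrite U0, V0; ring.
  - rewrite U1, V1; ring.
Qed.

(** Stands in for functional extensionality: the combinations built by [in_Vh_lincomb] match the
    intended functions only pointwise. *)
Lemma in_Vh_ext n x u v : (forall t, u t = v t) -> in_Vh n x u -> in_Vh n x v.
Proof.
  intros E [C [L [Z0 Z1]]]; repeat split.
  - intros t Ht eps Heps; destruct (C t Ht eps Heps) as [alp [Ha H]].
    exists alp; split; [exact Ha|]; intros s Hs; rewrite <- !E; auto.
  - intros j Hj; destruct (L j Hj) as [a [b H]]; exists a, b; intros t Ht.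
    rewrite <- E; auto.
  - rewrite <- E; exact Z0.
  - rewrite <- E; exact Z1.
Qed.

Lemma in_Vh_minus n x u v : in_Vh n x u -> in_Vh n x v ->
  in_Vh n x (fun t => u t - v t).
Proof.
  intros Hu Hv; apply (in_Vh_ext n x (fun t => 1 * u t + (-1) * v t)).
  - intros t; ring.
  - apply in_Vh_lincomb; assumption.
Qed.

Lemma in_Vh_sum n x (c : nat -> R) phi N :
  (forall i, (1 <= i <= N)%nat -> in_Vh n x (phi i)) -> (1 <= N)%nat ->
  in_Vh n x (fun t => sum_n_m (fun i => c i * phi i t) 1 N).
Proof.
  intros H HN; induction HN as [|N HN IH].
  - apply (in_Vh_ext n x (fun t => c 1%nat * phi 1%nat t + 0 * phi 1%nat t)).
    + intros t; rewrite sum_n_n; simpl; ring.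
    + apply in_Vh_lincomb; apply H; lia.
  - apply (in_Vh_ext n x
      (fun t => 1 * sum_n_m (fun i => c i * phi i t) 1 N + c (S N) * phi (S N) t)).
    + intros t; rewrite sum_n_Sm by lia; unfold plus; simpl; ring.
    + apply in_Vh_lincomb; [apply IH; intros; apply H | apply H]; lia.
Qed.

(** * The finite difference function and its nodal equations *)

Lemma Vh_fun_in_Vh n x phi U : (2 <= n)%nat -> nodal_basis n x phi ->
  in_Vh n x (Vh_fun n phi U).
Proof.
  intros Hn Hphi; apply in_Vh_sum; [|lia]; intros i Hi; apply Hphi, Hi.
Qed.

(** The range tests on the right allow [k] to fall outside the range, as do the neighbours of the
    first and last interior nodes. *)
Lemma sum_n_m_single (g : nat -> R) k a b : (a <= S b)%nat ->
  sum_n_m (fun l => if Nat.eq_dec k l then g l else 0) a b =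
  (if le_dec a k then if le_dec k b then g k else 0 else 0) :> R.
Proof.
  intros Hab; induction b as [|b IH].
  - destruct a as [|a].
    + rewrite sum_n_n; destruct (Nat.eq_dec k 0); repeat destruct (le_dec _ _); try lia;
        subst; reflexivity.
    + rewrite sum_n_m_zero by lia.
      repeat destruct (le_dec _ _); try lia; reflexivity.
  - destruct (Nat.eq_dec a (S (S b))) as [->|].
    + rewrite sum_n_m_zero by lia.
      repeat destruct (le_dec _ _); try lia; reflexivity.
    + rewrite sum_n_Sm, IH by lia; unfold plus; simpl.
      destruct (Nat.eq_dec k (S b)) as [->|]; repeat destruct (le_dec _ _); try lia; ring.
Qed.

Lemma Vh_fun_node n x phi U i : nodal_basis n x phi -> (1 <= i <= n - 1)%nat ->
  Vh_fun n phi U (x i) = coeff_mat 0 U (i - 1) 0.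
Proof.
  intros Hphi Hi; unfold Vh_fun.
  rewrite (sum_n_m_ext_loc _
    (fun l => if Nat.eq_dec i l then coeff_mat 0 U (l - 1) 0 else 0)).
  - rewrite sum_n_m_single by lia.
    repeat destruct (le_dec _ _); try lia; reflexivity.
  - intros l Hl; destruct (Hphi l Hl) as [_ Hk]; rewrite Hk by lia; unfold kron.
    destruct (Nat.eq_dec l i), (Nat.eq_dec i l); try lia; simpl; ring.
Qed.

(** The first and last rows lack an off-diagonal entry. Because [w] vanishes at both boundary nodes,
    the missing term can be added at no cost, and every row becomes the same difference of two
    consecutive slopes. *)
Lemma S_row_sum x (w : nat -> R) N i : w 0%nat = 0 -> w (S N) = 0 -> (S i <= N)%nat ->
  sum_n_m (fun k => S_entry x (S i) k * w k) 1 N =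
  (w (S i) - w i) / (x (S i) - x i) - (w (S (S i)) - w (S i)) / (x (S (S i)) - x (S i)) :> R.
Proof.
  intros H0 HN Hi.
  rewrite (sum_n_m_ext _ (fun k => plus
     (plus (if Nat.eq_dec (S i) k then S_entry x (S i) k * w k else 0)
           (if Nat.eq_dec (S (S i)) k then S_entry x (S i) k * w k else 0))
     (if Nat.eq_dec i k then S_entry x (S i) k * w k else 0))).
  2: { intros k; change (@plus R_AbelianMonoid) with Rplus; unfold S_entry.
       match goal with |- ?u = ?v => change (@eq R u v) end.
       repeat destruct (Nat.eq_dec _ _); try lia; ring. }
  rewrite !sum_n_m_plus, !sum_n_m_single by lia.
  assert (E1 : (if le_dec 1 (S (S i)) then if le_dec (S (S i)) N
      then S_entry x (S i) (S (S i)) * w (S (S i)) else 0 else 0)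
      = S_entry x (S i) (S (S i)) * w (S (S i))).
  { repeat destruct (le_dec _ _); try lia; [reflexivity|].
    replace (S (S i)) with (S N) by lia; rewrite HN; ring. }
  rewrite E1; clear E1.
  assert (E2 : (if le_dec 1 i then if le_dec i N
      then S_entry x (S i) i * w i else 0 else 0) = S_entry x (S i) i * w i).
  { repeat destruct (le_dec _ _); try lia; [reflexivity|].
    replace i with 0%nat by lia; rewrite H0; ring. }
  rewrite E2; clear E2.
  repeat destruct (le_dec _ _); try lia.
  change (@plus R_AbelianMonoid) with Rplus; unfold S_entry; rewrite !Nat.add_1_r.
  repeat destruct (Nat.eq_dec _ _); try lia.
  rewrite !hstep_S; unfold Rdiv; ring.
Qed.

(** This is row [i] of the matrix system, counted from 0, which belongs to node [S i]; the unknowns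
    are the nodal values of [Vh_fun]. *)
Lemma FD_equation n x phi f U i : (2 <= n)%nat -> mesh n x -> nodal_basis n x phi ->
  is_FD_solution n x f U -> (S i < n)%nat ->
  slope x (Vh_fun n phi U) i - slope x (Vh_fun n phi U) (S i) =
  ((x (S i) - x i) + (x (S (S i)) - x (S i))) / 2 * f (x (S i)).
Proof.
  intros Hn Hx Hphi HFD Hi.
  destruct (in_Vh_bc _ _ _ Hx (Vh_fun_in_Vh n x phi U Hn Hphi)) as [Hw0 Hwn].
  assert (E := proj1 (coeff_mat_ext (0 : R) _ _) HFD i 0%nat).
  unfold Mmult in E; rewrite !coeff_mat_bij in E by lia.
  unfold sum_n in E.
  rewrite (sum_n_m_ext_loc _ (fun l => S_entry x (S i) (S l) * Vh_fun n phi U (x (S l)))) in E.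
  2: { intros l Hl; unfold S_mat; rewrite coeff_mat_bij by lia.
       rewrite !Nat.add_1_r, (Vh_fun_node n x) by (auto; lia).
       replace (S l - 1)%nat with l by lia; reflexivity. }
  rewrite (sum_n_m_ext_loc (fun l => mult (coeff_mat zero (W_mat n x) i l) _)
    (fun l => if Nat.eq_dec i l then W_entry x (S i) (S l) * f (x (S l)) else 0)) in E.
  2: { intros l Hl; unfold W_mat, f_vec; rewrite !coeff_mat_bij by lia.
       rewrite !Nat.add_1_r; unfold W_entry, mult; simpl.
       repeat destruct (Nat.eq_dec _ _); try lia; simpl; ring. }
  (* Columns are counted from 0 and nodes from 1. After the shift the sum runs over the interior
     nodes, as [S_row_sum] requires. *)
  rewrite (sum_n_m_S (fun k => S_entry x (S i) k * Vh_fun n phi U (x k))) in E.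
  rewrite (S_row_sum x (fun k => Vh_fun n phi U (x k))), sum_n_m_single in E;
    [|lia|exact Hw0|replace (S (S (pred (n - 1)))) with n by lia; exact Hwn|lia].
  unfold slope; rewrite E.
  repeat destruct (le_dec _ _); try lia.
  unfold W_entry; destruct (Nat.eq_dec _ _); [|lia].
  rewrite !Nat.add_1_r, !hstep_S; reflexivity.
Qed.

(** * Summation by parts and discrete inequalities *)

(* Summation by parts of [sum (e_{j+1} - e_j) q_j], with the resulting nodal
   sum written interval by interval; only the term at node [m + 1] is left. *)
Lemma trapezoid_summation_by_parts (e q g h : nat -> R) m : e 0%nat = 0 ->
  (forall i, (i < m)%nat -> q i - q (S i) = (h i + h (S i)) / 2 * g (S i)) ->
  sum_f_R0 (fun j => (e (S j) - e j) * q j -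
    h j / 2 * (g j * e j + g (S j) * e (S j))) m
  = e (S m) * (q m - h m / 2 * g (S m)).
Proof.
  intros H0; induction m as [|m IH]; intros H; simpl.
  - rewrite H0; ring.
  - rewrite IH by (intros; apply H; lia); specialize (H m ltac:(lia)).
    replace (q m) with (q (S m) + (h m + h (S m)) / 2 * g (S m)) by lra.
    field.
Qed.

(** Cauchy-Schwarz for the products [sqrt h * (|d| / sqrt h)], with weights [h] of total 1, obtained
    by completing squares. *)
Lemma sum_Rabs_sqr_le (d h : nat -> R) m :
  (forall j, (j <= m)%nat -> 0 < h j) -> sum_f_R0 h m = 1 ->
  sum_f_R0 (fun j => Rabs (d j)) m ^ 2 <= sum_f_R0 (fun j => d j ^ 2 / h j) m.
Proof.
  intros Hh Hs; set (A := sum_f_R0 (fun j => Rabs (d j)) m).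
  (* [d^2 / h - 2 A |d| + A^2 h = h (|d| / h - A)^2] is nonnegative. *)
  assert (H : sum_f_R0 (fun j => 2 * A * Rabs (d j) - A ^ 2 * h j) m
              <= sum_f_R0 (fun j => d j ^ 2 / h j) m).
  { apply sum_Rle; intros j Hj; specialize (Hh j Hj).
    rewrite <- (pow2_abs (d j)).
    assert (0 <= h j * (Rabs (d j) / h j - A) ^ 2)
      by (apply Rmult_le_pos; [lra | apply pow2_ge_0]).
    replace (Rabs (d j) ^ 2 / h j) with
      (h j * (Rabs (d j) / h j - A) ^ 2 + (2 * A * Rabs (d j) - A ^ 2 * h j))
      by (field; lra).
    lra. }
  (* The left side of [H] sums to [2 A^2 - A^2 = A^2]. *)
  rewrite minus_sum in H.
  rewrite (sum_eq _ (fun j => Rabs (d j) * (2 * A))) in H by (intros; ring).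
  rewrite (sum_eq (fun j => A ^ 2 * h j) (fun j => h j * A ^ 2)) in H by (intros; ring).
  rewrite <- !scal_sum, Hs in H; fold A in H; lra.
Qed.

Lemma Rabs_node_le (a : nat -> R) m k : a 0%nat = 0 -> (k <= S m)%nat ->
  Rabs (a k) <= sum_f_R0 (fun j => Rabs (a (S j) - a j)) m.
Proof.
  intros H0; revert k; induction m as [|m IH]; intros k Hk.
  - simpl; destruct k as [|[|]]; [| |lia]; rewrite H0.
    + rewrite Rabs_R0; apply Rabs_pos.
    + rewrite Rminus_0_r; lra.
  - simpl; destruct (Nat.eq_dec k (S (S m))) as [->|].
    + specialize (IH (S m) ltac:(lia)).
      assert (T := Rabs_triang (a (S (S m)) - a (S m)) (a (S m))).
      replace (a (S (S m)) - a (S m) + a (S m)) with (a (S (S m))) in T by ring; lra.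
    + specialize (IH k ltac:(lia)); assert (P := Rabs_pos (a (S (S m)) - a (S m))); lra.
Qed.

(** * Energy products and the composite trapezoidal rule *)

Lemma is_RInt_Derive_mult m x u v : mesh (S m) x -> in_Vh (S m) x u -> in_Vh (S m) x v ->
  is_RInt (fun t => Derive u t * Derive v t) 0 1
    (sum_f_R0 (fun j => slope x u j * (v (x (S j)) - v (x j))) m).
Proof.
  intros Hx Hu Hv; assert (H := Hx); destruct H as [X0 [X1 Hlt]].
  rewrite <- X0, <- X1 at 1; apply is_RInt_mesh; intros j Hj.
  specialize (Hlt j ltac:(lia)).
  apply (is_RInt_ext (fun _ => slope x u j * slope x v j)).
  - rewrite Rmin_left, Rmax_right by lra; intros t Ht.
    rewrite !(in_Vh_Derive (S m) x _ j) by (auto; lia); reflexivity.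
  - replace (slope x u j * (v (x (S j)) - v (x j)))
      with (scal (x (S j) - x j) (slope x u j * slope x v j)).
    + apply (is_RInt_const (V := R_NormedModule)).
    + change (@eq R ((x (S j) - x j) * (slope x u j * slope x v j))
        (slope x u j * (v (x (S j)) - v (x j)))).
      unfold slope; field; lra.
Qed.

(** After a factor [h_j^2] is bounded by the squared mesh size, the [f2] part of a local error keeps
    a factor [h_j], and the [h_j] add up to 1. In the [f1] part, [h_j * |slope|] is the increment of
    [v], and these add up to [A]; its constant is [2 / 12 = 1 / 6]. *)
Lemma composite_trapezoid_error m x f f1 f2 v : mesh (S m) x -> C2_01 f f1 f2 ->
  in_Vh (S m) x v ->
  let h j := x (S j) - x j in
  let A := sum_f_R0 (fun j => Rabs (v (x (S j)) - v (x j))) m in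
  Rabs (RInt (fun t => f t * v t) 0 1 -
    sum_f_R0 (fun j => h j / 2 * (f (x j) * v (x j) + f (x (S j)) * v (x (S j)))) m)
  <= mesh_size (S m) x ^ 2 * (norm_inf f2 / 12 + norm_inf f1 / 6) * A.
Proof.
  intros Hx Hf Hv h A; assert (H := Hx); destruct H as [X0 [X1 Hlt]].
  destruct (in_Vh_bc _ _ _ Hx Hv) as [V0 _].
  destruct (C2_extension f f1 f2 Hf) as [F [F1 [EF [EF1 [DF DF1]]]]].
  destruct Hf as [_ [_ [_ [Cf1 Cf2]]]].
  set (M1 := norm_inf f1); set (M2 := norm_inf f2).
  set (B j := h j ^ 3 / 12 * (M2 * A + 2 * M1 * Rabs (slope x v j))).
  set (Q j := h j / 2 * (f (x j) * v (x j) + f (x (S j)) * v (x (S j)))).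
  assert (Hh : forall j, (j <= m)%nat -> 0 < h j).
  { intros j Hj; specialize (Hlt j ltac:(lia)); unfold h; lra. }
  assert (M1pos : 0 <= M1) by (apply norm_inf_pos, Cf1).
  assert (M2pos : 0 <= M2) by (apply norm_inf_pos, Cf2).
  assert (Apos : 0 <= A) by (apply cond_pos_sum; intros; apply Rabs_pos).
  set (T j := RInt (fun t => f t * v t) (x j) (x (S j))).
  assert (HT : forall j, (j <= m)%nat ->
    is_RInt (fun t => f t * v t) (x j) (x (S j)) (T j) /\ Rabs (T j - Q j) <= B j).
  { intros j Hj; specialize (Hh j Hj); unfold h in Hh.
    assert (HI : forall t, x j <= t <= x (S j) -> I01 t).
    { intros t Ht.
      assert (P := mesh_I01 _ _ j Hx ltac:(lia)).
      assert (P' := mesh_I01 _ _ (S j) Hx ltac:(lia)).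
      unfold I01 in *; lra. }
    assert (Hl := fun t (Ht : x j <= t <= x (S j)) =>
      in_Vh_linear _ _ _ j t Hx Hv ltac:(lia) Ht).
    (* The local estimate needs two-sided derivatives, so it is applied to the extension [F] and
       carried back to [f], which agrees with [F] on the element. *)
    destruct (trapezoid_error F F1 (fun t => f2 (clamp t)) (x j) (x (S j))
      (v (x j) - slope x v j * x j) (slope x v j) M1 M2 A) as [T' [HT HE]].
    - lra.
    - intros t Ht; apply DF, HI, Ht.
    - intros t _; apply DF1.
    - intros t _; apply continuity_pt_filterlim, continuity_clamp, Cf2.
    - intros t Ht; rewrite EF1 by apply HI, Ht; apply norm_inf_ge, HI, Ht; exact Cf1.
    - intros t _; apply norm_inf_ge, clamp_I01; exact Cf2.
    - intros t Ht.
      assert (P := Rabs_node_le (fun k => v (x k)) m j V0 ltac:(lia)).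
      assert (P' := Rabs_node_le (fun k => v (x k)) m (S j) V0 ltac:(lia)).
      simpl in P, P'; fold A in P, P'; apply Rabs_le_between in P; apply Rabs_le_between in P'.
      apply Rabs_le_between; rewrite (Hl (x (S j)) ltac:(lra)) in P'.
      (* [v] is affine, hence between its values at the two nodes. *)
      destruct (Rle_or_lt 0 (slope x v j)); split; nra.
    - apply (is_RInt_ext _ (fun t => f t * v t)) in HT.
      2: { rewrite Rmin_left, Rmax_right by lra; intros t Ht.
           rewrite EF, <- Hl by (try apply HI; lra); reflexivity. }
      unfold T; rewrite (is_RInt_unique _ _ _ _ HT); split; [exact HT|].
      rewrite !EF, <- !Hl in HE by (try apply HI; lra); exact HE. }
  rewrite (is_RInt_unique _ 0 1 (sum_f_R0 T m)).
  2: { rewrite <- X0, <- X1 at 1; apply is_RInt_mesh; intros j Hj; apply HT, Hj. }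
  rewrite <- minus_sum.
  eapply Rle_trans; [apply Rsum_abs|].
  set (H := mesh_size (S m) x).
  apply Rle_trans with (sum_f_R0 (fun j => h j * (H ^ 2 * (M2 / 12) * A)
    + Rabs (v (x (S j)) - v (x j)) * (H ^ 2 * (M1 / 6))) m).
  - apply sum_Rle; intros j Hj; eapply Rle_trans; [apply HT, Hj|].
    specialize (Hh j Hj).
    assert (HH : h j <= H) by (apply mesh_size_ge; lia).
    unfold B, slope; fold (h j).
    rewrite Rabs_div, (Rabs_pos_eq (h j)) by lra.
    set (d := Rabs _); assert (0 <= d) by apply Rabs_pos.
    replace (h j ^ 3 / 12 * (M2 * A + 2 * M1 * (d / h j)))
      with (h j ^ 2 * (h j * (M2 / 12 * A) + d * (M1 / 6))) by (field; lra).
    apply Rle_trans with (H ^ 2 * (h j * (M2 / 12 * A) + d * (M1 / 6))); [|right; ring].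
    apply Rmult_le_compat_r; [|apply pow_incr; lra].
    assert (0 <= h j * (M2 / 12 * A)) by (repeat apply Rmult_le_pos; lra).
    assert (0 <= d * (M1 / 6)) by (repeat apply Rmult_le_pos; lra).
    lra.
  - rewrite plus_sum, <- !scal_sum; fold A.
    unfold h; rewrite sum_telescope, X0, X1; right; field.
Qed.

(** * Energy estimate for the difference of the two solutions *)

Theorem theorem3p3 (n : nat) (x : nat -> R) (phi : nat -> R -> R)
  (f f1 f2 : R -> R) (uFE : R -> R) (U : @matrix R (n - 1) 1)
  (hn : (2 <= n)%nat)
  (hx : mesh n x)
  (hphi : nodal_basis n x phi)
  (hf : C2_01 f f1 f2)
  (hFE : is_FE_solution n x f uFE)
  (hFD : is_FD_solution n x f U) :
  energy_norm (fun t => uFE t - Vh_fun n phi U t)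
  <= (mesh_size n x) ^ 2 * (norm_inf f2 / 12 + norm_inf f1 / 6).
Proof.
  destruct n as [|m]; [lia|].
  set (w := Vh_fun (S m) phi U); set (e := fun t => uFE t - w t).
  set (C := mesh_size (S m) x ^ 2 * _).
  assert (Hw : in_Vh (S m) x w) by (apply Vh_fun_in_Vh; assumption).
  destruct hFE as [Hu HFE].
  assert (He : in_Vh (S m) x e) by (apply in_Vh_minus; assumption).
  destruct (in_Vh_bc _ _ _ hx He) as [E0 E1].
  assert (Hlt := proj2 (proj2 hx)).
  set (A := sum_f_R0 (fun j => Rabs (e (x (S j)) - e (x j))) m).
  (* The squared energy norm of [e], expressed by nodal values. *)
  set (E2 := sum_f_R0 (fun j => (e (x (S j)) - e (x j)) ^ 2 / (x (S j) - x j)) m).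
  assert (HE : energy_norm e = sqrt E2).
  { unfold energy_norm; f_equal; apply is_RInt_unique.
    apply (is_RInt_ext (fun t => Derive e t * Derive e t)); [intros; simpl; ring|].
    replace E2 with (sum_f_R0 (fun j => slope x e j * (e (x (S j)) - e (x j))) m).
    - apply is_RInt_Derive_mult; assumption.
    - apply sum_eq; intros j Hj; specialize (Hlt j ltac:(lia)).
      unfold slope; field; lra. }
  assert (HA : A ^ 2 <= E2).
  { apply (sum_Rabs_sqr_le (fun j => e (x (S j)) - e (x j)) (fun j => x (S j) - x j)).
    - intros j Hj; specialize (Hlt j ltac:(lia)); lra.
    - rewrite sum_telescope; destruct hx as [-> [-> _]]; ring. }
  assert (HC : E2 <= C * A).
  { assert (Err := composite_trapezoid_error m x f f1 f2 e hx hf He); cbv zeta in Err.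
    fold C A in Err.
    (* Testing the finite element equation with [e] turns the load integral into the energy product
       of [uFE] and [e]. Below, the trapezoidal sum becomes that of [w] and [e], and the two differ
       by [E2]. *)
    rewrite <- HFE, (is_RInt_unique _ _ _ _ (is_RInt_Derive_mult m x uFE e hx Hu He)) in Err
      by exact He.
    assert (P := trapezoid_summation_by_parts (fun j => e (x j)) (slope x w)
      (fun j => f (x j)) (fun j => x (S j) - x j) m E0
      (fun i Hi => FD_equation (S m) x phi f U i hn hx hphi hFD ltac:(lia))).
    (* The term left over at the last node carries the boundary value of [e], which is 0. *)
    simpl in P; rewrite E1, Rmult_0_l, minus_sum in P.
    replace E2 with (sum_f_R0 (fun j => slope x uFE j * (e (x (S j)) - e (x j))) m
      - sum_f_R0 (fun j => (e (x (S j)) - e (x j)) * slope x w j) m).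
    - apply Rabs_le_between in Err; lra.
    - rewrite <- minus_sum; apply sum_eq; intros j Hj; specialize (Hlt j ltac:(lia)).
      unfold slope, e; field; lra. }
  assert (HA0 : 0 <= A) by (apply cond_pos_sum; intros; apply Rabs_pos).
  assert (HC0 : 0 <= C).
  { destruct hf as [_ [_ [_ [Cf1 Cf2]]]].
    assert (P1 := norm_inf_pos f1 Cf1); assert (P2 := norm_inf_pos f2 Cf2).
    apply Rmult_le_pos; [apply pow2_ge_0 | lra]. }
  rewrite HE, <- (sqrt_pow2 C HC0); apply sqrt_le_1_alt.
  (* From [A^2 <= E2 <= C * A] with [A] and [C] nonnegative follows [A <= C], hence
     [E2 <= C * A <= C^2]; nothing has to be divided by a norm that might be 0. *)
  nra.
Qed.
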